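(* Let $m\ge0$ and $H_0=\vec\alpha\cdot\vec p+m\beta$. Let $\psi={}^t(\vec\psi_{11},\vec\psi_{12},\vec\psi_{21},\vec\psi_{22})\in\mathcal{H}\otimes\mathcal{H}\cong L^2(\mathbf{R}^6;\mathbf{C}^4)^4$. Then it holds that $$(H_0\otimes I_4+I_4\otimes H_0)\psi=\begin{pmatrix}2mI_4&h_2&h_1&0\\ h_2&0&0&h_1\\ h_1&0&0&h_2\\ 0&h_1&h_2&-2mI_4\end{pmatrix}\begin{pmatrix}\vec\psi_{11}\\\vec\psi_{12}\\\vec\psi_{21}\\\vec\psi_{22}\end{pmatrix},$$ where $h_1=(\vec\sigma\cdot\vec p_1)\otimes I_2$ and $h_2=I_2\otimes(\vec\sigma\cdot\vec p_2)$.
   Context: Let $\vec p=-i\nabla$ on $\mathbf{R}^3$; on functions of $(\mathbf r_1,\mathbf r_2)\in\mathbf{R}^3\times\mathbf{R}^3$, $\vec p_j=-i\nabla_{\mathbf r_j}$. Let $\sigma_1=\begin{pmatrix}0&1\\1&0\end{pmatrix}$, $\sigma_2=\begin{pmatrix}0&-i\\i&0\end{pmatrix}$, $\sigma_3=\begin{pmatrix}1&0\\0&-1\end{pmatrix}$, $\alpha_j=\begin{pmatrix}0&\sigma_j\\\sigma_j&0\end{pmatrix}$ $(j=1,2,3)$, $\beta=\begin{pmatrix}I_2&0\\0&-I_2\end{pmatrix}$; $\vec\alpha\cdot\vec p=\sum_j\alpha_jp_j$, $\vec\sigma\cdot\vec p=\sum_j\sigma_jp_j$. Let $\mathcal{H}=L^2(\mathbf{R}^3;\mathbf{C}^4)$.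 The tensor product $\mathcal{H}\otimes\mathcal{H}$ is identified with $L^2(\mathbf{R}^6;\mathbf{C}^{16})=L^2(\mathbf{R}^6;\mathbf{C}^4)^4$ as follows: if $\psi={}^t(\psi_1,\psi_2)$ and $\psi'={}^t(\psi_1',\psi_2')$ are in $\mathcal{H}$, with upper and lower parts $\psi_a={}^t(\psi_{a1},\psi_{a2})$, $\psi'_b={}^t(\psi'_{b1},\psi'_{b2})\in L^2(\mathbf{R}^3;\mathbf{C}^2)$, then $\psi\otimes\psi'$ has blocks, in the order $(a,b)=(1,1),(1,2),(2,1),(2,2)$, equal to ${}^t\big(\psi_{a1}(\mathbf r_1)\psi'_{b1}(\mathbf r_2),\ \psi_{a1}(\mathbf r_1)\psi'_{b2}(\mathbf r_2),\ \psi_{a2}(\mathbf r_1)\psi'_{b1}(\mathbf r_2),\ \psi_{a2}(\mathbf r_1)\psi'_{b2}(\mathbf r_2)\big)$. The operator $H_0\otimes I_4$ (resp. $I_4\otimes H_0$) is $H_0$ acting on the first (resp. second) tensor factor, i.e. in the variable $\mathbf r_1$ (resp. $\mathbf r_2$) and on the corresponding $\mathbf{C}^4$. For $2\times2$ matrices, $A\otimes B=(a_{ij}B)$ is the Kronecker product, acting on each block $\vec\psi_{ab}\in\mathbf{C}^4=\mathbf{C}^2\otimes\mathbf{C}^2$. *)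

(* Defs.v *)
From HB Require Import structures.
From mathcomp Require Import all_boot all_order all_algebra.
From mathcomp Require Import complex mxtens.
From mathcomp Require Import all_classical all_reals all_analysis.

Set Implicit Arguments.
Unset Strict Implicit.
Unset Printing Implicit Defensive.
Import Order.TTheory GRing.Theory Num.Theory.
Import numFieldNormedType.Exports.
Local Open Scope classical_set_scope.
Local Open Scope ring_scope.
Local Open Scope complex_scope.

(* Kronecker (lexicographic) enumeration of pairs of indices:
   mxtens_index (i, j) = i * n + j. *)
Arguments mxtens_index {m n} ij.
Arguments mxtens_unindex {m n} k.

Notation R3 R := (R * R * R)%type.
Notation R6 R := (R3 R * R3 R)%type.

(* The library's own sigma-finite instance on [m1 \x m2] cannot be inferred: it
   is shadowed by the instance for probability measures. *)
Section SigmaFiniteProduct.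
Context d1 d2 (T1 : measurableType d1) (T2 : measurableType d2)
  (R : realType) (m1 : {sigma_finite_measure set T1 -> \bar R})
  (m2 : {sigma_finite_measure set T2 -> \bar R}).

Definition sf_product : set (T1 * T2) -> \bar R := (m1 \x m2)%E.

HB.instance Definition _ := Measure.on sf_product.

Let sf_product_sigma_finite : sigma_finite setT sf_product.
Proof.
have /sigma_finiteP[F [TF ndF Foo]] := sigma_finiteT m1.
have /sigma_finiteP[G [TG ndG Goo]] := sigma_finiteT m2.
exists (fun n => F n `*` G n).
  rewrite -setXTT TF TG predeqE => -[x y]; split.
    move=> [/= [n _ Fnx] [k _ Gky]]; exists (maxn n k) => //; split.
    - by move: x Fnx; exact/subsetPset/ndF/leq_maxl.
    - by move: y Gky; exact/subsetPset/ndG/leq_maxr.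
  by move=> [n _ []/= ? ?]; split; exists n.
move=> k; have [? ?] := Foo k; have [? ?] := Goo k.
split; first exact: measurableX.
by rewrite /sf_product product_measure1E// lte_mul_pinfty// ge0_fin_numE.
Qed.

HB.instance Definition _ :=
  Measure_isSigmaFinite.Build _ _ _ sf_product sf_product_sigma_finite.

End SigmaFiniteProduct.

Definition leb3 (R : realType) :=
  sf_product (sf_product (@lebesgue_measure R) (@lebesgue_measure R))
             (@lebesgue_measure R).
HB.instance Definition _ (R : realType) := SigmaFiniteMeasure.on (@leb3 R).

Definition leb6 (R : realType) := sf_product (@leb3 R) (@leb3 R).
HB.instance Definition _ (R : realType) := SigmaFiniteMeasure.on (@leb6 R).

(* An element psi of L^2 need not be differentiable, so p_j psi = -i d_j psi is
   taken in the sense of distributions, i.e. as a functional on test functions.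
   Real test functions suffice, the values being complex.  Linearity and
   continuity of functionals are not needed to define the operations below,
   which preserve them, so they are not made part of the type. *)
Section Distributions.
Variables (R : realType) (X : normedModType R).

(* C^oo: Frechet differentiability at every order of directional derivation. *)
Definition smooth (phi : X -> R) : Prop :=
  forall (s : seq X) (x : X),
    differentiable (foldr (fun (v : X) (g : X -> R) => 'D_v g) phi s) x.

Definition compactly_supported (phi : X -> R) : Prop :=
  compact (closure [set x | phi x != 0]).

Record test : Type := Test {
  test_fun :> X -> R;
  test_smooth : smooth test_fun;
  test_supp : compactly_supported test_fun }.

Lemma smooth_derive (v : X) (phi : X -> R) :
  smooth phi -> smooth ('D_v phi).
Proof. by move=> h s x; have := h (rcons s v) x; rewrite foldr_rcons. Qed.

Lemma compactly_supported_derive (v : X) (phi : X -> R) :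
  compactly_supported phi -> compactly_supported ('D_v phi).
Proof.
move=> h; apply: (subclosed_compact _ h); first exact: closed_closure.
suff sub : [set x | 'D_v phi x != 0] `<=` closure [set x | phi x != 0].
  rewrite [X in _ `<=` X](closure_id _).1; last exact: closed_closure.
  exact: closureS.
move=> x /= Dx0; apply: contrapT => ncl; move/eqP: Dx0; apply.
have phi0 : \forall y \near x, phi y = cst 0 y.
  have : (~` closure [set x | phi x != 0]) x by [].
  rewrite -interiorC; apply: filterS => y /= /negP.
  by rewrite negbK => /eqP.
by rewrite (near_eq_derive _ phi0) derive_cst.
Qed.

Definition test_derive (v : X) (phi : test) : test :=
  Test (@smooth_derive v phi (@test_smooth phi))
       (@compactly_supported_derive v phi (@test_supp phi)).

Definition distr : Type := test -> R[i].
HB.instance Definition _ := GRing.Lmodule.on distr.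

Definition distr_derive (v : X) (T : distr) : distr :=
  fun phi => - T (test_derive v phi).

Definition momentum (v : X) (T : distr) : distr :=
  fun phi => - 'i * distr_derive v T phi.

End Distributions.

Definition e3 (R : realType) (j : 'I_3) : R3 R :=
  ((j == 0 :> nat)%:R, (j == 1 :> nat)%:R, (j == 2 :> nat)%:R).

Section TwoParticles.
Variable R : realType.

Definition p1 (j : 'I_3) : distr (R6 R) -> distr (R6 R) :=
  momentum (e3 R j, 0).
Definition p2 (j : 'I_3) : distr (R6 R) -> distr (R6 R) :=
  momentum (0, e3 R j).

(* L^2(R^6; C^n), as square-integrable measurable representatives. *)
Definition L2 n (psi : 'cV[R6 R -> R[i]]_n) : Prop :=
  forall k, (fun r => complex.Re (psi k 0 r)) \in Lfun (@leb6 R) 2%:E /\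
            (fun r => complex.Im (psi k 0 r)) \in Lfun (@leb6 R) 2%:E.

Definition to_distr (f : R6 R -> R[i]) : distr (R6 R) := fun phi =>
  \int[@leb6 R]_r (complex.Re (f r) * phi r) +i*
  \int[@leb6 R]_r (complex.Im (f r) * phi r).

(* psi (x) psi' in C^4 (x) C^4 = C^16. *)
Definition tensor (psi psi' : 'cV[R3 R -> R[i]]_4) : 'cV[R6 R -> R[i]]_(4 * 4) :=
  \col_k (fun r => psi (mxtens_unindex k).1 0 r.1 *
                   psi' (mxtens_unindex k).2 0 r.2).

End TwoParticles.

(* The component of index c of the upper (a = 0) or lower (a = 1) part of a
   4-spinor. *)
Definition spinor (a c : 'I_2) : 'I_4 := @mxtens_index 2 2 (a, c).

(* C^4 (x) C^4 = (C^4)^4: the blocks are listed in the order 11, 12, 21, 22 of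
   the pairs (a, b) of parts, and the components (c, d) inside a block in the
   same order. *)
Definition blocks V (psi : 'cV[V]_(4 * 4)) : 'cV['cV[V]_4]_4 :=
  \col_(k < 4) \col_(l < 4)
    let: (a, b) := @mxtens_unindex 2 2 k in
    let: (c, d) := @mxtens_unindex 2 2 l in
    psi (mxtens_index (spinor a c, spinor b d)) 0.

Lemma blocks_tensor (R : realType) (psi psi' : 'cV[R3 R -> R[i]]_4)
    (a b c d : 'I_2) :
  blocks (tensor psi psi') (@mxtens_index 2 2 (a, b)) 0
                           (@mxtens_index 2 2 (c, d)) 0 =
  (fun r => psi (spinor a c) 0 r.1 * psi' (spinor b d) 0 r.2).
Proof. by rewrite mxE mxE !(@mxtens_indexK 2 2) [LHS]mxE (@mxtens_indexK 4 4). Qed.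

(* Square matrices whose entries are operators on V, acting on columns. *)
Section OperatorMatrices.

Definition opmul (V : zmodType) n (A : 'M[V -> V]_n) (u : 'cV[V]_n) : 'cV[V]_n :=
  \col_i \sum_j A i j (u j 0).

Definition opscalar (K : pzRingType) (V : lmodType K) n (c : K) :
    'M[V -> V]_n :=
  \matrix_(i, j) (fun T => (c *+ (i == j)) *: T).

(* Kronecker product (a_ij B), the product of entries being composition. *)
Definition opkron V n p (A : 'M[V -> V]_n) (B : 'M[V -> V]_p) :
    'M[V -> V]_(n * p) :=
  \matrix_(i, j) (A (mxtens_unindex i).1 (mxtens_unindex j).1 \o
                  B (mxtens_unindex i).2 (mxtens_unindex j).2).

End OperatorMatrices.

Definition mx2 (T : Type) (a b c d : T) : 'M[T]_2 :=
  \matrix_(i, j) if i == 0 then (if j == 0 then a else b)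
                 else (if j == 0 then c else d).

Section Dirac.
Variable R : realType.

Definition pauli (j : 'I_3) : 'M[R[i]]_2 :=
  match val j with
  | 0%N => mx2 0 1 1 0
  | 1%N => mx2 0 (- 'i) 'i 0
  | _ => mx2 1 0 0 (- 1)
  end.

Definition alpha (j : 'I_3) : 'M[R[i]]_4 :=
  @block_mx _ 2 2 2 2 0 (pauli j) (pauli j) 0.

Definition beta : 'M[R[i]]_4 := @block_mx _ 2 2 2 2 1%:M 0 0 (- 1%:M).

(* The operators below are written for a momentum p with components p_1, p_2,
   p_3, so that they can be used in either of the variables r_1, r_2. *)
Variables (V : lmodType R[i]) (p : 'I_3 -> V -> V).

Definition sigma_p : 'M[V -> V]_2 :=
  \matrix_(i, k) (fun T => \sum_j pauli j i k *: p j T).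

Definition H0 (m : R) : 'M[V -> V]_4 :=
  \matrix_(i, k) (fun T =>
    \sum_j alpha j i k *: p j T + (m%:C * beta i k) *: T).

End Dirac.

Section TwoBody.
Variable R : realType.
Notation D := (distr (R6 R)).

Definition H0_I (m : R) : 'M[D -> D]_(4 * 4) :=
  opkron (H0 (@p1 R) m) (opscalar D 4 1).

Definition I_H0 (m : R) : 'M[D -> D]_(4 * 4) :=
  opkron (opscalar D 4 1) (H0 (@p2 R) m).

Definition h1 : 'cV[D]_4 -> 'cV[D]_4 :=
  opmul (opkron (sigma_p (@p1 R)) (opscalar D 2 1)).

Definition h2 : 'cV[D]_4 -> 'cV[D]_4 :=
  opmul (opkron (opscalar D 2 1) (sigma_p (@p2 R))).

Definition block_hamiltonian (m : R) : 'M['cV[D]_4 -> 'cV[D]_4]_4 :=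
  let M := opmul (opscalar D 4 (2 * m)%:C) in
  let N := opmul (opscalar D 4 (- (2 * m))%:C) in
  let O := fun=> 0 in
  let rows := [:: [:: M;  h2; h1; O];
                  [:: h2; O;  O;  h1];
                  [:: h1; O;  O;  h2];
                  [:: O;  h1; h2; N]] in
  \matrix_(i, j) nth O (nth [::] rows i) j.

End TwoBody.

(* Main.v *)
(** Splitting each C^4 as C^2 (x) C^2, an operator of the first factor acts
    blockwise; [alpha_j] is off-diagonal in the parts, with entry [sigma_j], and
    [beta] is the sign of the part.  So the block [(a, b)] of the left-hand side
    is [h1] of the block with [a] flipped, plus [h2] of the block with [b]
    flipped, plus [m ((-1)^a + (-1)^b)] times the block [(a, b)] itself. *)
Require Import Defs.
From mathcomp Require Import all_boot all_order all_algebra.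
From mathcomp Require Import complex mxtens.
From mathcomp Require Import all_classical all_reals all_analysis.
Import Order.TTheory GRing.Theory Num.Theory.
Local Open Scope ring_scope.
Local Open Scope complex_scope.

Set Implicit Arguments.
Unset Strict Implicit.
Unset Printing Implicit Defensive.

(** Operator matrices have arbitrary maps as entries; this makes an operator composed with a zero
    scalar vanish. *)
Lemma momentum0 (R : realType) (X : normedModType R) (v : X) :
  momentum v (0 : distr X) = 0.
Proof.
by apply: funext => phi; rewrite /momentum /distr_derive oppr0 mulr0.
Qed.

Lemma big_mxtens_index (V : nmodType) n p (F : 'I_(n * p) -> V) :
  \sum_k F k = \sum_i \sum_j F (mxtens_index (i, j)).
Proof.
rewrite pair_big /= (reindex mxtens_index) /=; last first.
  by exists mxtens_unindex => k _; rewrite (mxtens_indexK, mxtens_unindexK).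
by apply: eq_bigr => -[].
Qed.

(** Case analysis on a part that yields the literals [0] and [1], on which equality tests and
    [rev_ord] compute. *)
Variant ord2_spec : 'I_2 -> Type := Ord2_0 : ord2_spec 0 | Ord2_1 : ord2_spec 1.

Lemma ord2P i : ord2_spec i.
Proof.
case: i => -[|[|//]] ilt.
  by rewrite (_ : Ordinal ilt = 0); [exact: Ord2_0 | exact: val_inj].
by rewrite (_ : Ordinal ilt = 1); [exact: Ord2_1 | exact: val_inj].
Qed.

Lemma opmulDl (V : zmodType) n (A B : 'M[V -> V]_n) (u : 'cV[V]_n) :
  opmul (A + B) u = opmul A u + opmul B u.
Proof.
by apply/colP => i; rewrite !mxE -big_split; apply: eq_bigr => j _; rewrite mxE.
Qed.

Lemma opmul_opscalar (K : pzRingType) (V : lmodType K) n (c : K) (u : 'cV[V]_n) i :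
  opmul (opscalar V n c) u i 0 = c *: u i 0.
Proof.
rewrite mxE (bigD1 i) //= big1 ?addr0 => [|j ji]; rewrite mxE.
  by rewrite eqxx.
by rewrite eq_sym (negPf ji) scale0r.
Qed.

Section KroneckerWithIdentity.
Variables (K : pzRingType) (V : lmodType K) (n p : nat) (u : 'cV[V]_(n * p)).

(** In an entry of this product the scalar of the identity acts first, so its off-diagonal zeros
    leave [A i j 0]; hence the hypothesis. With the identity on the left, the scalar acts last and
    kills the term by itself. *)
Lemma opmul_opkron1r (A : 'M[V -> V]_n) i k : (forall i j, A i j 0 = 0) ->
  opmul (opkron A (opscalar V p (1 : K))) u (mxtens_index (i, k)) 0 =
  \sum_j A i j (u (mxtens_index (j, k)) 0).
Proof.
move=> A0; rewrite mxE big_mxtens_index; apply: eq_bigr => j _.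
rewrite (bigD1 k) //= big1 ?addr0 => [|l lk]; rewrite !mxE !mxtens_indexK /=.
  by rewrite eqxx scale1r.
by rewrite eq_sym (negPf lk) scale0r A0.
Qed.

Lemma opmul_opkron1l (A : 'M[V -> V]_p) i k :
  opmul (opkron (opscalar V n (1 : K)) A) u (mxtens_index (i, k)) 0 =
  \sum_j A k j (u (mxtens_index (i, j)) 0).
Proof.
rewrite mxE big_mxtens_index exchange_big; apply: eq_bigr => j _.
rewrite (bigD1 i) //= big1 ?addr0 => [|l li]; rewrite !mxE !mxtens_indexK /=.
  by rewrite eqxx scale1r.
by rewrite eq_sym (negPf li) scale0r.
Qed.

End KroneckerWithIdentity.

Lemma blocksE V (u : 'cV[V]_(4 * 4)) (a b c d : 'I_2) :
  blocks u (@mxtens_index 2 2 (a, b)) 0 (@mxtens_index 2 2 (c, d)) 0 =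
  u (mxtens_index (spinor a c, spinor b d)) 0.
Proof. by rewrite mxE mxE !(@mxtens_indexK 2 2). Qed.

(** The lexicographic index is [2 * a + c]; in this form the entries of [block_mx] can be read
    off. *)
Lemma spinor_shift (a c : 'I_2) :
  spinor a c = if a == 0 then lshift 2 c else rshift 2 c.
Proof. by case: (ord2P a); apply: val_inj. Qed.

Lemma alpha_spinor (R : realType) j (a c a' c' : 'I_2) :
  alpha R j (spinor a c) (spinor a' c') = if a' == a then 0 else pauli R j c c'.
Proof.
rewrite /alpha !spinor_shift; case: (ord2P a); case: (ord2P a') => /=.
- by rewrite (@block_mxEul _ 2 2 2 2) mxE.
- by rewrite (@block_mxEur _ 2 2 2 2).
- by rewrite (@block_mxEdl _ 2 2 2 2).
- by rewrite (@block_mxEdr _ 2 2 2 2) mxE.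
Qed.

Lemma beta_spinor (R : realType) (a c a' c' : 'I_2) :
  beta R (spinor a c) (spinor a' c') =
  if a' == a then (-1) ^+ a *+ (c == c') else 0.
Proof.
rewrite /beta !spinor_shift; case: (ord2P a); case: (ord2P a') => /=.
- by rewrite (@block_mxEul _ 2 2 2 2) mxE.
- by rewrite (@block_mxEur _ 2 2 2 2) mxE.
- by rewrite (@block_mxEdl _ 2 2 2 2) mxE.
- by rewrite (@block_mxEdr _ 2 2 2 2) !mxE expr1 mulNrn.
Qed.

Section DiracRows.
Variables (R : realType) (V : lmodType R[i]) (p : 'I_3 -> V -> V).
Hypothesis p0 : forall j, p j 0 = 0.

Lemma sigma_p0 i k : sigma_p p i k 0 = 0.
Proof. by rewrite mxE big1 // => j _; rewrite p0 scaler0. Qed.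

Lemma H0_0 m i k : H0 p m i k 0 = 0.
Proof.
by rewrite mxE scaler0 addr0 big1 // => j _; rewrite p0 scaler0.
Qed.

Lemma H0_spinor m (a c a' c' : 'I_2) T :
  H0 p m (spinor a c) (spinor a' c') T =
  if a' == a then (m%:C * (-1) ^+ a *+ (c == c')) *: T
  else sigma_p p c c' T.
Proof.
rewrite mxE beta_spinor; under eq_bigr do rewrite alpha_spinor.
case: eqP => _; last by rewrite mulr0 scale0r addr0 mxE.
rewrite big1 => [|j _]; last by rewrite scale0r.
by rewrite add0r mulrnAr.
Qed.

Lemma sum_H0_spinor m (a c : 'I_2) (u : 'I_4 -> V) :
  \sum_j H0 p m (spinor a c) j (u j) =
  \sum_c' sigma_p p c c' (u (spinor (rev_ord a) c')) +
  (m%:C * (-1) ^+ a) *: u (spinor a c).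
Proof.
(* The index in ['I_4] is read as a pair (part, component); the part [a] will give the mass term and
   the opposite part [rev_ord a] the Pauli term. *)
rewrite (@big_mxtens_index _ 2 2) (bigD1 a) // (bigD1 (rev_ord a)) /=; last first.
  by case: (ord2P a).
(* No third part exists: the remaining sum is empty. *)
rewrite [X in _ + (_ + X)]big1 ?addr0 => [|a']; last first.
  by case: (ord2P a); case: (ord2P a').
rewrite addrC; congr (_ + _).
  apply: eq_bigr => c' _; rewrite [LHS](@H0_spinor m a c (rev_ord a)).
  by case: (ord2P a).
rewrite (bigD1 c) //= big1 ?addr0 => [|c' c'c].
  by rewrite [LHS](@H0_spinor m a c a) !eqxx.
by rewrite [LHS](@H0_spinor m a c a) eqxx eq_sym (negPf c'c) scale0r.
Qed.

End DiracRows.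

(** One formula for the four rows: flipping [a] or [b] locates [h1] and [h2], and the sum of signs
    is 2, 0, 0, -2 in the order 11, 12, 21, 22. *)
Lemma opmul_block_hamiltonian (R : realType) (m : R)
    (u : 'cV['cV[distr (R6 R)]_4]_4) (a b : 'I_2) (l : 'I_4) :
  opmul (block_hamiltonian m) u (@mxtens_index 2 2 (a, b)) 0 l 0 =
  h1 (u (@mxtens_index 2 2 (rev_ord a, b)) 0) l 0 +
  h2 (u (@mxtens_index 2 2 (a, rev_ord b)) 0) l 0 +
  (m%:C * ((-1) ^+ a + (-1) ^+ b)) *: u (@mxtens_index 2 2 (a, b)) 0 l 0.
Proof.
(* Instances of [mxE] restricted to given matrices, here and below, keep [h1] and [h2] folded. *)
have entry i j : block_hamiltonian m i j = _ := mxE _ _ i j.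
have lift1 : lift ord0 ord0 = 1 :> 'I_2 by exact: val_inj.
have rev0 : rev_ord 0 = 1 :> 'I_2 by exact: val_inj.
have rev1 : rev_ord 1 = 0 :> 'I_2 by exact: val_inj.
rewrite mxE (@big_mxtens_index _ 2 2) !big_ord_recl !big_ord0 !addr0 !entry.
have addE (v w : 'cV[distr (R6 R)]_4) : (v + w) l 0 = v l 0 + w l 0 := mxE _ _ l 0.
have zeroE : (0 : 'cV[distr (R6 R)]_4) l 0 = 0 := mxE _ _ l 0.
have ord00 : ord0 = 0 :> 'I_2 by [].
rewrite lift1 !ord00 !addE.
have two : m%:C * (1 + 1) = (2 * m)%:C by rewrite rmorphM rmorph_nat mulrC.
case: (ord2P a); case: (ord2P b);
  rewrite /= ?rev0 ?rev1 ?zeroE ?opmul_opscalar ?add0r ?addr0 ?expr0 ?expr1.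
- by rewrite two addrC [X in _ + X]addrC addrA.
- by rewrite subrr mulr0 scale0r addr0 addrC.
- by rewrite addNr mulr0 scale0r addr0.
- by rewrite -opprD mulrN two rmorphN addrA.
Qed.

Theorem theorem3p2 (R : realType) (m : R) (m_ge0 : 0 <= m)
    (psi : 'cV[R6 R -> R[i]]_(4 * 4)) (psi_L2 : L2 psi) :
  let Psi := map_mx (@to_distr R) psi in
  blocks (opmul (H0_I m + I_H0 m) Psi) = opmul (block_hamiltonian m) (blocks Psi).
Proof.
move=> Psi; apply/colP => k; case: (@mxtens_indexP 2 2 k) => a b.
apply/colP => l; case: (@mxtens_indexP 2 2 l) => c d.
have p10 j : @p1 R j 0 = 0 by exact: momentum0.
have p20 j : @p2 R j 0 = 0 by exact: momentum0.
rewrite opmul_block_hamiltonian blocksE opmulDl mxE.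
rewrite opmul_opkron1r; last exact: H0_0.
rewrite opmul_opkron1l !sum_H0_spinor.
rewrite /h1 /h2 (@opmul_opkron1r _ _ 2 2); last exact: sigma_p0.
(* The two mass terms are grouped apart from the two Pauli sums, which then match [h1] and [h2] term
   by term. *)
rewrite (@opmul_opkron1l _ _ 2 2) blocksE mulrDr scalerDl addrACA.
by congr (_ + _ + _); apply: eq_bigr => k' _; rewrite blocksE.
Qed.
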